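(* Let $\mathcal{O}$ be the maximal order of an imaginary quadratic field, and let $M=\begin{pmatrix} a&b\\ \bar b&d\end{pmatrix}$ be a positive definite unimodular Hermitian matrix with coefficients in $\mathcal{O}$ (with $a,d\in\mathbb{Z}$, $b\in\mathcal{O}$). The reduction algorithm described in the context, applied to $M$, terminates, and its output is the reduced matrix congruent to $M$.
   Context: Let $K$ be the fraction field of $\mathcal{O}$ and fix an embedding $\epsilon_0\colon K\to\mathbb{C}$. Write $P^*$ for the conjugate transpose of a matrix or (column) vector $P$. Matrices $M_1,M_2\in \mathrm{GL}_2(\mathcal{O})$ are congruent if $P^*M_1P=M_2$ for some $P\in\mathrm{GL}_2(\mathcal{O})$. Ordering. For $\alpha\in\mathcal{O}$ write $\alpha>0$ if either the trace of $\alpha$ is positive, or the trace of $\alpha$ is $0$ and $\epsilon_0(\alpha)$ has positive imaginary part; write $\alpha>\beta$ if $\alpha-\beta>0$. This is a total ordering on $\mathcal{O}$. Let $\mathcal{H}$ be the set of positive definite unimodular Hermitian $2\times 2$ matrices with coefficients in $\mathcal{O}$. To $M=\begin{pmatrix} a&b\\ \bar b&d\end{pmatrix}\in\mathcal{H}$ associate $\chi(M)=(a,d,b)\in\mathbb{N}\times\mathbb{N}\times\mathcal{O}$, and order $\mathcal{H}$ totally by $M_1<M_2$ iff $\chi(M_1)<\chi(M_2)$ lexicographically. A matrix $M\in\mathcal{H}$ is reduced if $M\le M'$ for all $M'\in\mathcal{H}$ congruent to $M$; every $M\in\mathcal{H}$ is congruent to a unique reduced matrix. Reduction algorithm (input $M$):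 1. Set $a'=1$. 2. Compute the set $A'$ of vectors $\mathbf{x}=(x_1,x_2)\in\mathcal{O}^2$ such that $\mathbf{x}^*M\mathbf{x}=a'$ and $x_1,x_2$ generate the unit ideal of $\mathcal{O}$. If $A'=\emptyset$, increment $a'$ and repeat this step. 3. Set $d'=a'$. 4. Compute the set $D'$ of vectors $\mathbf{y}=(y_1,y_2)\in\mathcal{O}^2$ such that $\mathbf{y}^*M\mathbf{y}=d'$ and $y_1,y_2$ generate the unit ideal of $\mathcal{O}$. If $D'=\emptyset$, increment $d'$ and repeat this step. 5. Initialize $\mathcal{M}$ to be the empty set. 6. For each $\mathbf{x}\in A'$ and $\mathbf{y}\in D'$ such that $\mathbf{x},\mathbf{y}$ generate $\mathcal{O}^2$ as an $\mathcal{O}$-module, let $M'$ be the matrix representing the Hermitian form $M$ written on the basis $\mathbf{x},\mathbf{y}$ of $\mathcal{O}^2$ (i.e. $M'=P^*MP$ with $P$ the matrix with columns $\mathbf{x},\mathbf{y}$), and add $M'$ to $\mathcal{M}$. 7. If $\mathcal{M}$ is empty, increment $d'$ and return to Step 4. 8. Find the smallest element $M'$ of $\mathcal{M}$ under the ordering of $\mathcal{H}$. 9. Output $M'$. *)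

(* Defs.v *)
From HB Require Import structures.
From mathcomp Require Import all_boot all_order all_algebra all_field.
From mathcomp Require Import ring finmap boolp classical_sets reals.
From mathcomp Require Import complex.

Set Implicit Arguments.
Unset Strict Implicit.
Unset Printing Implicit Defensive.

Import Order.TTheory GRing.Theory Num.Theory.

Local Open Scope ring_scope.

Definition imaginary_quadratic (R : realType) (K : fieldExtType rat) : Prop :=
  \dim {:K} = 2 /\ ~ inhabited {rmorphism K -> R}.

(* The maximal order of K, as the subring of the elements integral over Z. *)
Definition maxorder_pred (K : fieldExtType rat) : {pred K} :=
  fun x => `[< integralOver (intr : int -> K) x >].
Arguments maxorder_pred K : clear implicits.

Lemma maxorder_subring (K : fieldExtType rat) :
  subring_closed (maxorder_pred K).
Proof.
split; first by apply/asboolP; apply: integral1.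
- by move=> x y /asboolP ox /asboolP oy; apply/asboolP; apply: integral_sub.
- by move=> x y /asboolP ox /asboolP oy; apply/asboolP; apply: integral_mul.
Qed.

HB.instance Definition _ (K : fieldExtType rat) :=
  GRing.isSubringClosed.Build K (maxorder_pred K) (@maxorder_subring K).

Record maxorder (K : fieldExtType rat) := MaxOrder {
  maxorder_val :> K;
  maxorder_valP : maxorder_val \in maxorder_pred K }.

HB.instance Definition _ K := [isSub for @maxorder_val K].
HB.instance Definition _ K := [Choice of maxorder K by <:].
HB.instance Definition _ K :=
  [SubChoice_isSubComNzRing of maxorder K by <:].

Section Units.
Variable K : fieldExtType rat.

Definition maxorder_unit : {pred maxorder K} :=
  fun x => `[< exists y, y * x = 1 >].

Definition maxorder_inv (x : maxorder K) : maxorder K :=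
  xget x [set y | y * x = 1]%classic.

Lemma maxorder_mulVr : {in maxorder_unit, left_inverse 1 maxorder_inv *%R}.
Proof.
move=> x /asboolP[y yx].
exact: (@xgetPex _ x [set z | z * x = 1]%classic (ex_intro _ y yx)).
Qed.

Lemma maxorder_unitPl (x y : maxorder K) : y * x = 1 -> maxorder_unit x.
Proof. by move=> yx; apply/asboolP; exists y. Qed.

Lemma maxorder_invr_out : {in [predC maxorder_unit], maxorder_inv =1 id}.
Proof.
move=> x /asboolP nx; rewrite /maxorder_inv.
by case: xgetP => // y _ /= yx; case: nx; exists y.
Qed.

HB.instance Definition _ := GRing.ComNzRing_hasMulInverse.Build (maxorder K)
  maxorder_mulVr maxorder_unitPl maxorder_invr_out.

End Units.

HB.instance Definition _ K :=
  [SubComUnitRing_isSubIntegralDomain of maxorder K by <:].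

(* The trace K -> rat: the trace of the multiplication by x on a rat-basis. *)
Definition field_trace (K : fieldExtType rat) (x : K) : rat :=
  \tr (passmx.mxof (vbasis {:K}) (vbasis {:K}) (amull x)).

Lemma dim2_quad (K : fieldExtType rat) (k : K) : \dim {:K} = 2 ->
  (exists a : rat, k = a%:A) \/ exists a b : rat, k * k = a%:A + b *: k.
Proof.
move=> dK; have [/vlineP[a ->]|k1] := boolP (k \in <[1]>%VS); first by left; exists a.
right.
have fr : free [:: k; 1].
  by rewrite free_cons span_seq1 k1 seq1_free oner_eq0.
have bs : basis_of {:K} [:: k; 1] by rewrite basisEfree fr subvf dK.
have : k * k \in {:K}%VS by rewrite memvf.
rewrite -(span_basis bs) span_cons span_seq1 => /memv_addP[u /vlineP[b ->]].
by move=> [v /vlineP[a ->] ->]; exists a, b; rewrite addrC.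
Qed.

Section Hermitian.
Variables (R : realType) (K : fieldExtType rat) (eps0 : {rmorphism K -> R[i]}).
Local Notation O := (maxorder K).

Definition emb (x : O) : R[i] := eps0 (val x).

(* Complex conjugation on O: such a y exists, by emb_conjO below. *)
Definition conjO (x : O) : O := xget x [set y | emb y = (emb x)^*]%classic.

Lemma integral_conj (x : O) (y : K) :
  eps0 y = (emb x)^* -> y \in maxorder_pred K.
Proof.
move=> ey; have /asboolP[p mp rp] := maxorder_valP x.
apply/asboolP; exists p => //.
apply/rootP; apply: (fmorph_inj eps0).
rewrite rmorph0 -horner_map ey /= -[RHS](rmorph0 Num.conj).
have /= <- : eps0 (map_poly intr p).[val x] = 0 by rewrite (rootP rp) rmorph0.
rewrite -!horner_map /=; congr (_.[_]).
by apply/polyP => i; rewrite !coef_map /= !rmorph_int.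
Qed.

Lemma emb_conjO (x : O) : \dim {:K} = 2 -> emb (conjO x) = (emb x)^*.
Proof.
move=> dK.
apply: (@xgetPex _ x [set y | emb y = (emb x)^*]%classic) => /=.
suff [y ey] : exists y : K, eps0 y = (emb x)^*.
  by exists (MaxOrder (@integral_conj _ _ ey)).
have eA a : eps0 a%:A = ratr a by rewrite alg_num_field fmorph_rat.
have [[a xa]|[a [b xx]]] := @dim2_quad K (val x) dK.
  by exists (val x); rewrite /emb xa eA fmorph_rat.
rewrite /emb; set z := eps0 _.
have [zr|zr] := eqVneq z^* z; first by exists (val x); rewrite zr.
exists (b%:A - val x); rewrite rmorphB /= eA -/z.
have e1 : z * z = ratr a + ratr b * z.
  by rewrite /z -(rmorphM eps0) xx rmorphD /= eA -mulr_algl rmorphM /= eA.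
have e2 : z^* * z^* = ratr a + ratr b * z^*.
  have qr (q : rat) : (ratr q : R[i])^* = ratr q by exact: fmorph_rat.
  by have := congr1 Num.conj e1;
    rewrite rmorphD (rmorphM _ z) (rmorphM _ (ratr b)) /= !qr.
have: (z^* - z) * (z^* - (ratr b - z)) = 0.
  have -> : (z^* - z) * (z^* - (ratr b - z)) =
     (z^* * z^* - ratr b * z^*) - (z * z - ratr b * z) by ring.
  by rewrite e1 e2; ring.
by move/eqP; rewrite mulf_eq0 subr_eq0 (negPf zr) /= subr_eq0 => /eqP.
Qed.

Definition ctr m n (P : 'M[O]_(m, n)) : 'M[O]_(n, m) := map_mx conjO P^T.

Definition gt0O (x : O) : Prop :=
  0 < field_trace (val x) \/
  field_trace (val x) = 0 /\ 0 < complex.Im (emb x).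

Definition ltO (x y : O) : Prop := gt0O (y - x).

Definition posdef (M : 'M[O]_2) : Prop :=
  forall v : 'cV[R[i]]_2, v != 0 ->
    0 < ((map_mx Num.conj v^T) *m map_mx emb M *m v) 0 0.

Definition inH (M : 'M[O]_2) : Prop :=
  [/\ ctr M = M, posdef M & M \in unitmx].

Definition congruentO (M1 M2 : 'M[O]_2) : Prop :=
  exists P : 'M[O]_2, P \in unitmx /\ ctr P *m M1 *m P = M2.

(* The natural number whose image in O is x (0 if there is none). *)
Definition natO (x : O) : nat := xget 0 [set n | n%:R = x]%classic.

Definition chi (M : 'M[O]_2) : nat * nat * O :=
  (natO (M 0 0), natO (M 1 1), M 0 1).

Definition ltH (M1 M2 : 'M[O]_2) : Prop :=
  let: (a1, d1, b1) := chi M1 in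
  let: (a2, d2, b2) := chi M2 in
  (a1 < a2)%N \/ a1 = a2 /\ ((d1 < d2)%N \/ d1 = d2 /\ ltO b1 b2).

Definition leH (M1 M2 : 'M[O]_2) : Prop := ltH M1 M2 \/ M1 = M2.

Definition reduced (M : 'M[O]_2) : Prop :=
  inH M /\ forall M', inH M' -> congruentO M M' -> leH M M'.

Definition unit_ideal (x : 'cV[O]_2) : Prop :=
  exists u1 u2 : O, u1 * x 0 0 + u2 * x 1 0 = 1.

Definition generate_O2 (x y : 'cV[O]_2) : Prop :=
  forall z : 'cV[O]_2, exists c d : O, z = c *: x + d *: y.

Section Algorithm.
Variable M : 'M[O]_2.

Definition is_level_set (m : nat) (A : {fset 'cV[O]_2}) : Prop :=
  forall x : 'cV[O]_2,
    x \in A <-> (ctr x *m M *m x) 0 0 = m%:R /\ unit_ideal x.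

Definition on_basis (x y : 'cV[O]_2) : 'M[O]_2 :=
  let P : 'M[O]_2 := row_mx x y in ctr P *m M *m P.

Definition candidates (A D : {fset 'cV[O]_2}) : {fset 'M[O]_2} :=
  [fset on_basis x y | x in A, y in D & `[< generate_O2 x y >]]%fset.

(* Control points of the algorithm, with the variables live at each of them:
   about to compute A' (Step 2), about to compute D' (Step 4), about to build
   the set of matrices (Step 5), halted (Step 9). *)
Inductive state : Type :=
| AtA of nat
| AtD of {fset 'cV[O]_2} & nat
| AtM of {fset 'cV[O]_2} & {fset 'cV[O]_2} & nat
| Halt of 'M[O]_2.

Definition start : state := AtA 1.

(* "Compute the set" yields a finite set: were a level set infinite, the
   execution would be stuck in a state other than Halt. *)
Inductive step : state -> state -> Prop :=
| step_incrA a A : is_level_set a A -> A = fset0%fset ->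
    step (AtA a) (AtA a.+1)
| step_foundA a A : is_level_set a A -> A <> fset0%fset ->
    step (AtA a) (AtD A a)
| step_incrD A d D : is_level_set d D -> D = fset0%fset ->
    step (AtD A d) (AtD A d.+1)
| step_foundD A d D : is_level_set d D -> D <> fset0%fset ->
    step (AtD A d) (AtM A D d)
| step_retry A D d : candidates A D = fset0%fset ->
    step (AtM A D d) (AtD A d.+1)
| step_halt A D d N : N \in candidates A D ->
    (forall N', N' \in candidates A D -> leH N N') ->
    step (AtM A D d) (Halt N).

Inductive reachable : state -> Prop :=
| reach_start : reachable start
| reach_step s t : reachable s -> step s t -> reachable t.

(* No infinite execution, and an execution can only stop by producing an
   output. *)
Definition terminates : Prop :=
  Acc (fun t s => step s t) start /\
  forall s, reachable s -> (exists t, step s t) \/ (exists N, s = Halt N).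

Definition outputs (N : 'M[O]_2) : Prop := reachable (Halt N).

End Algorithm.

End Hermitian.

(* Main.v *)
Require Import Defs.
From HB Require Import structures.
From mathcomp Require Import all_boot all_order all_algebra all_field.
From mathcomp Require Import reals complex.
From mathcomp Require Import zify ring finmap boolp classical_sets.

Import Order.TTheory GRing.Theory Num.Theory.

(** The theorem is true because the form M takes positive integral values on O^2,
    each of them at finitely many vectors only, and because the bases of O^2 are
    the columns of the matrices that define congruences.

    Discreteness. A real element of K is rational, since otherwise K would embed
    in the reals (real_rat), and a rational integral element is an integer. So
    every nonnegative real element of O is a natural number (emb_ge0_nat). This
    applies to norms and to the values of a positive definite Hermitian form at
    vectors of O^2. Only finitely many elements of O have a bounded norm, because
    they are roots of finitely many quadratic polynomials (bounded_norm_finite),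
    and completing the square bounds the coordinates of a vector by the value of
    the form (level_bound). Hence each level set computed by the algorithm is
    finite (level_set_exists).

    Bases. Two vectors generate O^2 exactly when the matrix of their columns is
    invertible (generate_O2P), and a vector is part of a basis exactly when its
    coordinates generate the unit ideal (unit_ideal_col, unit_ideal_complete).
    Let a be the least value of M at vectors of the latter kind, and d the least
    value at vectors completing to a basis some vector of value a. Then the
    matrices congruent to M with diagonal (a, d) are those that the algorithm
    compares when its counters are a and d, and the smallest of them is reduced
    (reduced_of_least). The order on H is total, so it is also the only reduced
    matrix congruent to M (reduced_unique).

    It remains to follow the counters. They start at 1 and at a, which are at
    most a and d, and they are incremented only when the current value is ruled
    out, so they never go beyond a and d; this invariant comes with a natural number that decreases at each
    transition (step_invariant). The latter gives termination, the former says
    that the run halts exactly at (a, d). *)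

Local Open Scope ring_scope.

(** * The trace and the integrality of rational numbers *)

Lemma field_trace_linear (K : fieldExtType rat) :
  scalar (@field_trace K).
Proof.
move=> a x y; rewrite /field_trace.
have -> : amull (a *: x + y) = a *: amull x + amull y by rewrite linearP.
by rewrite passmx.mxof_linear mxtraceD mxtraceZ.
Qed.

HB.instance Definition _ (K : fieldExtType rat) :=
  GRing.isSemilinear.Build rat K rat *%R (@field_trace K)
    (GRing.semilinear_linear (@field_trace_linear K)).

Lemma field_trace_rat (K : fieldExtType rat) (q : rat) :
  field_trace (q%:A : K) = q * (\dim {:K})%:R.
Proof.
rewrite linearZ /= /field_trace amull1 passmx.mxof1 ?mxtrace1 //.
exact: basis_free (vbasisP _).
Qed.

(** Integrality of a rational descends from K to Q because the scalars embed Q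
    in K, and over Q it is the integrality of rational algebraic integers. *)
Lemma integral_rat (K : fieldExtType rat) (q : rat) :
  (q%:A : K) \in maxorder_pred K -> q \is a Num.int.
Proof.
move=> /asboolP[p mp rp].
have rq : root (map_poly intr p) q.
  apply/rootP; apply: (fmorph_inj (in_alg K)); rewrite rmorph0.
  rewrite -horner_map /= -[RHS](rootP rp); congr (_.[_]).
  by apply/polyP => i; rewrite !coef_map /= scaler_int.
suff /intrP[z qz] : (ratr q : algC) \is a Num.int.
  apply/intrP; exists z; apply: (fmorph_inj (ratr : rat -> algC)).
  by rewrite [RHS]ratr_int -[RHS]qz.
apply: Cint_rat_Aint; first exact: Crat_rat.
apply: (@root_monic_Aint (map_poly intr p)).
- have <- : map_poly ratr (map_poly intr p : {poly rat}) = map_poly intr p :> {poly algC}.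
    by apply/polyP => i; rewrite !coef_map /= rmorph_int.
  by rewrite fmorph_root.
- exact: monic_map.
- by apply/polyOverP => i; rewrite coef_map /= intr_int.
Qed.

(** * Finite sets, least elements and pairs of indices *)

Lemma lift_ord0 : lift ord0 ord0 = 1 :> 'I_2.
Proof. exact: val_inj. Qed.

Lemma ord2_cases (i : 'I_2) : i = 0 \/ i = 1.
Proof. by case: i => [[|[|//]] ?]; [left|right]; apply: val_inj. Qed.

Lemma least_nat (P : nat -> Prop) :
  (exists n, P n) -> exists2 m, P m & forall n, P n -> (m <= n)%N.
Proof.
move=> [n Pn]; have ex : exists n, `[< P n >] by exists n; apply/asboolP.
exists (ex_minn ex); case: ex_minnP => m /asboolP// _ min k /asboolP; exact: min.
Qed.

Lemma finite_of_fibers (T U : eqType) (f : T -> U) (l : seq U) :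
  (forall u, exists s : seq T, forall x, f x = u -> x \in s) ->
  exists s : seq T, forall x, f x \in l -> x \in s.
Proof.
move=> fib; elim: l => [|u l [s Hs]]; first by exists [::].
have [t Ht] := fib u; exists (t ++ s) => x.
by rewrite inE mem_cat => /orP[/eqP/Ht->|/Hs->] //; rewrite orbT.
Qed.

Section Algorithm.
Variables (R : realType) (K : fieldExtType rat) (eps0 : {rmorphism K -> R[i]}).
Hypothesis hK : imaginary_quadratic R K.
Local Notation O := (maxorder K).
Local Notation emb := (Defs.emb eps0).
Local Notation conjO := (Defs.conjO eps0).

HB.instance Definition _ := GRing.RMorphism.copy emb (eps0 \o val).

(** * Real elements, the order and the conjugation on O *)

Lemma emb_inj : injective emb.
Proof. by move=> x y /fmorph_inj /val_inj. Qed.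

(** The only use of K being imaginary: if k is real and irrational, then 1 and k
    form a rational basis of K, so the image of eps0 is real and the real part
    of eps0 is an embedding of K in R. *)
Lemma real_rat (k : K) :
  complex.Im (eps0 k) = 0 -> exists q : rat, k = q%:A.
Proof.
case: hK => dK nreal ik0.
have [/vlineP[a ->]|k1] := boolP (k \in <[1]>%VS); first by exists a.
case: nreal.
have fr : free [:: k; 1].
  by rewrite free_cons span_seq1 k1 seq1_free oner_eq0.
have bs : basis_of {:K} [:: k; 1] by rewrite basisEfree fr subvf dK.
have im0 x : complex.Im (eps0 x) = 0.
  have : x \in {:K}%VS by rewrite memvf.
  rewrite -(span_basis bs) span_cons span_seq1 => /memv_addP[u /vlineP[b ->]].
  move=> [v /vlineP[a ->] ->].
  rewrite -[b *: k]mulr_algl rmorphD rmorphM /= !alg_num_field !fmorph_rat.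
  rewrite -!(fmorph_rat (real_complex R)) [eps0 k]complexE ik0.
  by simpc.
pose f x := complex.Re (eps0 x).
have fB : zmod_morphism f.
  by move=> x y; rewrite /f rmorphB; case: (eps0 x) (eps0 y) => a b [].
have fM : monoid_morphism f.
  split=> [|x y]; rewrite /f; first by rewrite rmorph1.
  rewrite rmorphM /=; move: (im0 x) (im0 y).
  by case: (eps0 x) => a b; case: (eps0 y) => c d /= -> ->; rewrite mulr0 subr0.
pose fA := GRing.isZmodMorphism.Build K R f fB.
pose fm := GRing.isMonoidMorphism.Build K R f fM.
by constructor; exact: (HB.pack f fA fm : {rmorphism K -> R}).
Qed.

(** This is what makes the algorithm discrete: norms, values of Hermitian forms
    and their determinants are nonnegative reals, hence natural numbers. *)
Lemma emb_ge0_nat (x : O) : 0 <= emb x -> exists n, x = n%:R.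
Proof.
move=> x0; have [q xq] := real_rat (val x) (ger0_Im x0).
have /integral_rat /intrP[z qz] : q%:A \in maxorder_pred K.
  by rewrite -xq; exact: valP.
have ex : emb x = z%:~R by rewrite /Defs.emb xq qz scaler_int rmorph_int.
move: x0; rewrite ex ler0z; case: z {qz} ex => // n ex _.
by exists n; apply: emb_inj; rewrite ex rmorph_nat.
Qed.

Lemma emb_nat_inj (m n : nat) : m%:R = n%:R :> O -> m = n.
Proof.
by move/(congr1 emb); rewrite !rmorph_nat => /eqP; rewrite eqr_nat => /eqP.
Qed.

Lemma natO_nat (n : nat) : natO (n%:R : O) = n.
Proof.
apply: emb_nat_inj.
exact: (@xgetPex _ 0%N [set m | m%:R = n%:R :> O]%classic (ex_intro _ n erefl)).
Qed.

Lemma gt0O_add (x y : O) : gt0O eps0 x -> gt0O eps0 y -> gt0O eps0 (x + y).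
Proof.
rewrite /gt0O !raddfD /=.
case=> [x0|[-> x0]] [y0|[-> y0]]; [left|left|left|right]; rewrite ?add0r ?addr0 //.
  by rewrite addr_gt0.
by rewrite addr_gt0.
Qed.

Lemma gt0O_irr : ~ gt0O eps0 (0 : O).
Proof.
by rewrite /gt0O !raddf0 /= !ltxx; case=> // -[].
Qed.

(** If the trace and the imaginary part both vanish, then x is a rational number
    by real_rat, and its trace is twice itself. *)
Lemma gt0O_total (x : O) : x != 0 -> gt0O eps0 x \/ gt0O eps0 (- x).
Proof.
move=> x0; rewrite /gt0O !raddfN /=.
have [t|t|t] := ltgtP (field_trace (val x)) 0; first by right; left; rewrite oppr_gt0.
  by left; left.
rewrite t oppr0.
have [i|i|i] := ltgtP (complex.Im (emb x)) 0.
- by right; right; split=> //; rewrite oppr_gt0.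
- by left; right.
have [q xq] := real_rat (val x) i.
move: t; rewrite xq field_trace_rat (proj1 hK) => /eqP.
rewrite mulf_eq0 pnatr_eq0 orbF => /eqP q0.
by case/eqP: x0; apply: val_inj; rewrite xq q0 scale0r rmorph0.
Qed.

Lemma emb_conj (x : O) : emb (conjO x) = (emb x)^*.
Proof. exact/emb_conjO/(proj1 hK). Qed.

Lemma conjO_zmod : zmod_morphism conjO.
Proof. by move=> x y; apply: emb_inj; rewrite rmorphB /= !emb_conj !rmorphB. Qed.

Lemma conjO_monoid : monoid_morphism conjO.
Proof.
by split=> [|x y]; apply: emb_inj; rewrite ?rmorphM /= !emb_conj !(rmorph1, rmorphM).
Qed.

HB.instance Definition _ := GRing.isZmodMorphism.Build O O conjO conjO_zmod.
HB.instance Definition _ := GRing.isMonoidMorphism.Build O O conjO conjO_monoid.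

Lemma conjOK : involutive conjO.
Proof. by move=> x; apply: emb_inj; rewrite !emb_conj conjCK. Qed.

(** * Elements of bounded norm *)

Lemma normO_nat (x : O) : exists n, x * conjO x = n%:R.
Proof. by apply: emb_ge0_nat; rewrite rmorphM /= emb_conj mul_conjC_ge0. Qed.

(** The norms of x and x + 1 determine the trace of x, hence the monic quadratic
    polynomial that has x as a root; both are natural numbers, so only finitely
    many pairs are possible below a bound, and each one allows at most two
    values of x. *)
Lemma bounded_norm_finite (B : nat) : exists s : seq O,
  forall x n, x * conjO x = n%:R -> (n <= B)%N -> x \in s.
Proof.
pose nrm (x : O) := natO (x * conjO x).
have nrmE x : x * conjO x = (nrm x)%:R.
  by have [n xn] := normO_nat x; rewrite /nrm xn natO_nat.
have nrm1 (x : O) : (nrm (x + 1)%R <= (nrm x).*2.+2)%N.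
  (* Parallelogram law: |x + 1|^2 + |x - 1|^2 = 2 |x|^2 + 2. *)
  have [m hm] := normO_nat (x - 1).
  have : (nrm (x + 1) + m)%:R = ((nrm x).*2.+2)%:R :> O.
    rewrite -addn2 -muln2 !natrD natrM -!nrmE -hm !(rmorphD, rmorphB, rmorph1) /=.
    by ring.
  by move/emb_nat_inj => <-; rewrite leq_addr.
have [|s Hs] := @finite_of_fibers _ _ (fun x : O => (nrm x, nrm (x + 1)))
    [seq (i, j) | i <- iota 0 B.+1, j <- iota 0 (B.*2.+3)]; last first.
  exists s => x n xn nB; apply: Hs; apply/allpairsP; exists (nrm x, nrm (x + 1)).
  have nn : nrm x = n by rewrite /nrm xn natO_nat.
  split; rewrite ?mem_iota ?add0n ?nn ?ltnS //.
  by apply: leq_trans (nrm1 x) _; rewrite nn !ltnS leq_double.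
case=> a b.
have [[x0 [xa xb]]|nx] := pselect (exists x : O, nrm x = a /\ nrm (x + 1) = b); last first.
  by exists [::] => x [xa xb]; case: nx; exists x.
exists [:: x0; conjO x0] => x [ya yb]; rewrite !inE.
(* x and x0 have equal norm and trace, so x is a root of (X - x0)(X - conj x0). *)
rewrite -subr_eq0 -[x == conjO _]subr_eq0 -mulf_eq0; apply/eqP.
have e1 : x * conjO x = x0 * conjO x0 by rewrite !nrmE xa ya.
have : (x + 1) * conjO (x + 1) = (x0 + 1) * conjO (x0 + 1) by rewrite !nrmE xb yb.
rewrite !rmorphD !rmorph1 => e2.
have -> : (x - x0) * (x - conjO x0) =
  x * ((x + 1) * (conjO x + 1) - (x0 + 1) * (conjO x0 + 1))
  - (x + 1) * (x * conjO x - x0 * conjO x0) by ring.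
by rewrite e1 e2 !subrr; ring.
Qed.

(** * Congruence and values of Hermitian forms *)

Local Notation ctr := (Defs.ctr eps0).
Local Notation val_at M x := ((ctr x *m M *m x) 0 0).

Lemma ctrM m n p (A : 'M[O]_(m, n)) (B : 'M[O]_(n, p)) :
  ctr (A *m B) = ctr B *m ctr A.
Proof. by rewrite /Defs.ctr trmx_mul map_mxM. Qed.

Lemma ctrK m n (A : 'M[O]_(m, n)) : ctr (ctr A) = A.
Proof. by apply/matrixP => i j; rewrite !mxE conjOK. Qed.

Lemma ctr1 n : ctr (1%:M : 'M[O]_n) = 1%:M.
Proof. by rewrite /Defs.ctr trmx1 map_mx1. Qed.

Lemma ctr_unit n (P : 'M[O]_n) : P \in unitmx -> ctr P \in unitmx.
Proof. by rewrite !unitmxE /Defs.ctr det_map_mx det_tr; apply: rmorph_unit. Qed.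

Lemma emb_ctr m n (A : 'M[O]_(m, n)) :
  map_mx emb (ctr A) = map_mx Num.conj (map_mx emb A)^T.
Proof. by apply/matrixP => i j; rewrite !mxE emb_conj. Qed.

Lemma congruentO_trans (A B C : 'M[O]_2) :
  congruentO eps0 A B -> congruentO eps0 B C -> congruentO eps0 A C.
Proof.
case=> P [uP <-] [Q [uQ <-]]; exists (P *m Q).
by rewrite unitmx_mul uP uQ ctrM !mulmxA.
Qed.

Lemma congruentO_sym (A B : 'M[O]_2) :
  congruentO eps0 A B -> congruentO eps0 B A.
Proof.
case=> P [uP <-]; exists (invmx P); split; first by rewrite unitmx_inv.
by rewrite !mulmxA -ctrM -!mulmxA mulmxV // mulmx1 ctr1 mul1mx.
Qed.

Lemma congruentO_inH (A B : 'M[O]_2) :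
  inH eps0 A -> congruentO eps0 A B -> inH eps0 B.
Proof.
move=> [hA pA uA] [P [uP <-]]; split.
- by rewrite !ctrM ctrK hA mulmxA.
- move=> v v0; rewrite !map_mxM emb_ctr /=.
  set Pe := map_mx emb P.
  have -> : map_mx Num.conj v^T *m
      (map_mx Num.conj Pe^T *m map_mx emb A *m Pe) *m v =
      map_mx Num.conj (Pe *m v)^T *m map_mx emb A *m (Pe *m v).
    by rewrite trmx_mul map_mxM !mulmxA.
  apply: pA; apply: contraNneq v0 => Pv0.
  have /(congr1 (map_mx emb)) := mulVmx uP.
  rewrite map_mxM map_mx1 -/Pe => PV.
  by rewrite -[v]mul1mx -PV -mulmxA Pv0 mulmx0.
- by rewrite !unitmx_mul uP uA ctr_unit.
Qed.

(** Positive definiteness over the complex numbers makes the value at a nonzero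
    vector of O^2 a positive real element of O, so emb_ge0_nat applies. *)
Lemma val_at_nat (M : 'M[O]_2) (x : 'cV[O]_2) : inH eps0 M ->
  exists2 n : nat, val_at M x = n%:R & x != 0 -> (0 < n)%N.
Proof.
move=> [_ pM _]; have [->|x0] := eqVneq x 0.
  by exists 0%N => //; rewrite mulmx0 mxE.
have pos : 0 < emb (val_at M x).
  have -> : emb (val_at M x) = (map_mx Num.conj (map_mx emb x)^T
      *m map_mx emb M *m map_mx emb x) 0 0.
    by rewrite -emb_ctr -!map_mxM [RHS]mxE.
  apply: pM; apply: contraNneq x0 => /matrixP ex0; apply/eqP/matrixP => i j.
  by apply: emb_inj; have := ex0 i j; rewrite !mxE => ->; rewrite rmorph0.
have [n xn] := emb_ge0_nat _ (ltW pos).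
by exists n => // _; move: pos; rewrite xn rmorph_nat ltr0n.
Qed.

Lemma congr_diag (M P : 'M[O]_2) i :
  (ctr P *m M *m P) i i = val_at M (col i P).
Proof.
rewrite !mxE; apply: eq_bigr => k _; rewrite !mxE; congr (_ * _).
by apply: eq_bigr => l _; rewrite !mxE.
Qed.

Lemma inH_diag (M : 'M[O]_2) i : inH eps0 M ->
  exists2 n : nat, M i i = n%:R & (0 < n)%N.
Proof.
move=> hM; have := congr_diag M 1%:M i; rewrite ctr1 mul1mx mulmx1 => ->.
have [n -> n0] := val_at_nat _ (col i 1%:M) hM; exists n => //; apply: n0.
apply/eqP => /matrixP/(_ i 0); rewrite !mxE eqxx; exact/eqP/oner_neq0.
Qed.

Lemma val_at_expand (M : 'M[O]_2) (x : 'cV[O]_2) : inH eps0 M ->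
  val_at M x = M 0 0 * (x 0 0 * conjO (x 0 0)) + M 0 1 * (x 1 0 * conjO (x 0 0))
    + conjO (M 0 1) * (x 0 0 * conjO (x 1 0)) + M 1 1 * (x 1 0 * conjO (x 1 0)).
Proof.
move=> [hM _ _]; have -> : conjO (M 0 1) = M 1 0 by rewrite -[in RHS]hM !mxE.
rewrite !(mxE, big_ord_recl, big_ord0) /= lift_ord0.
by ring.
Qed.

(** * Finiteness of the level sets *)

(** Completing the square: with D the determinant of M, a * M(x) is the norm of
    a x1 + b x2 plus D times the norm of x2, and symmetrically for d and x1.
    As D is a positive integer, the norms of x1 and x2 are at most (a + d) M(x). *)
Lemma level_bound (M : 'M[O]_2) : inH eps0 M -> exists B : nat,
  forall (x : 'cV[O]_2) n, val_at M x = n%:R -> forall i,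
  exists2 m, x i 0 * conjO (x i 0) = m%:R & (m <= B * n)%N.
Proof.
move=> hM; have [a Ma a0] := inH_diag M 0 hM; have [d Md d0] := inH_diag M 1 hM.
pose D := M 0 0 * M 1 1 - M 0 1 * conjO (M 0 1).
have conj_nat (k : nat) : conjO k%:R = k%:R by rewrite rmorph_nat.
have [c Dc c0] : exists2 c : nat, D = c%:R & (0 < c)%N.
  (* M takes the value a * D at (-b, a), the vector that kills the square. *)
  pose v : 'cV[O]_2 := \col_i (if i == 0 then - M 0 1 else M 0 0).
  have v0 : v != 0.
    apply: contraTneq a0 => /matrixP/(_ 1 0); rewrite !mxE /= Ma => a0.
    by rewrite (emb_nat_inj a 0).
  have [n vn /(_ v0) n0] := val_at_nat M v hM.
  have aD : a%:R * D = n%:R.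
    rewrite -vn val_at_expand // /D !mxE /= !rmorphN /= Ma conj_nat; ring.
  have eD : emb D = n%:R / a%:R.
    move/(congr1 emb): aD; rewrite rmorphM !rmorph_nat => <-.
    by rewrite mulrC mulKf // pnatr_eq0 -lt0n.
  have [c Dc] : exists c, D = c%:R.
    by apply: emb_ge0_nat; rewrite eD divr_ge0 ?ler0n.
  exists c => //; rewrite lt0n; apply: contraTneq n0 => c0.
  by rewrite -leqNgt leqn0; apply/eqP/emb_nat_inj; rewrite -aD Dc c0 mulr0.
have bound (u v w : O) (e n : nat) : e%:R * n%:R = u * conjO u + D * (w * conjO w) ->
    exists2 m, w * conjO w = m%:R & (m <= e * n)%N.
  have [k ->] := normO_nat u; have [m ->] := normO_nat w.
  rewrite Dc -!natrM -natrD => /emb_nat_inj ->; exists m => //.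
  by rewrite (leq_trans _ (leq_addl _ _)) // leq_pmull.
exists (a + d)%N => x n xn i; have [->|->] := ord2_cases i.
  have [|m m1 m2] := bound (M 1 1 * x 1 0 + conjO (M 0 1) * x 0 0) 0 (x 0 0) d n.
    rewrite -xn val_at_expand // /D !(rmorphD, rmorphM) /= conjOK Ma Md !conj_nat; ring.
  by exists m; rewrite // (leq_trans m2) // leq_mul2r leq_addl orbT.
have [|m m1 m2] := bound (M 0 0 * x 0 0 + M 0 1 * x 1 0) 0 (x 1 0) a n.
  rewrite -xn val_at_expand // /D !(rmorphD, rmorphM) /= Ma Md !conj_nat; ring.
by exists m; rewrite // (leq_trans m2) // leq_mul2r leq_addr orbT.
Qed.

Lemma level_set_exists (M : 'M[O]_2) (n : nat) : inH eps0 M ->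
  exists A, is_level_set eps0 M n A.
Proof.
move=> hM; have [B HB] := level_bound M hM.
have [s Hs] := bounded_norm_finite (B * n).
pose vec (p : O * O) : 'cV[O]_2 := \col_i (if i == 0 then p.1 else p.2).
exists [fset x in [seq vec p | p <- [seq (u, v) | u <- s, v <- s]] |
  `[< val_at M x = n%:R /\ unit_ideal x >]]%fset => x.
rewrite !inE /=; split=> [/andP[_ /asboolP//]|hx].
rewrite asboolT // andbT; apply/mapP; exists (x 0 0, x 1 0); last first.
  apply/matrixP => i j; rewrite !mxE ord1; case: i => [[|[|//]] ?] /=;
  by congr (x _ _); apply: val_inj.
have xs i : x i 0 \in s by have [m] := HB x n hx.1 i; apply: Hs.
by apply/allpairsP; exists (x 0 0, x 1 0); split; rewrite /= ?xs.
Qed.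

(** * Bases of O^2 *)

Lemma unit_ideal_col (P : 'M[O]_2) i : P \in unitmx -> unit_ideal (col i P).
Proof.
move=> uP; have /matrixP/(_ i i) := mulVmx uP.
rewrite !(mxE, big_ord_recl, big_ord0) eqxx addr0 lift_ord0 => e.
by exists (invmx P i 0), (invmx P i 1); rewrite !mxE e.
Qed.

Lemma row_mx_cols (P : 'M[O]_2) : row_mx (col 0 P) (col 1 P) = P.
Proof.
apply/matrixP => i j; case: (split_ordP j) => k ->.
  by rewrite row_mxEl mxE; congr (P i _); apply: val_inj; rewrite ord1.
by rewrite row_mxEr mxE; congr (P i _); apply: val_inj; rewrite ord1.
Qed.

Lemma cols_row_mx (x y : 'cV[O]_2) :
  col 0 (row_mx x y : 'M_2) = x /\ col 1 (row_mx x y : 'M_2) = y.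
Proof.
split; apply/matrixP => i j; rewrite mxE ord1.
  by rewrite -[RHS](row_mxEl x y); congr (row_mx _ _ _ _); apply: val_inj.
by rewrite -[RHS](row_mxEr x y); congr (row_mx _ _ _ _); apply: val_inj.
Qed.

(** Links the module-theoretic condition of the algorithm to the matrices of
    congruences: the two vectors are the columns of the base change. *)
Lemma generate_O2P (x y : 'cV[O]_2) :
  generate_O2 x y <-> (row_mx x y : 'M_2) \in unitmx.
Proof.
have comb (w : 'cV[O]_2) : (row_mx x y : 'M_2) *m w = w 0 0 *: x + w 1 0 *: y.
  have := mul_row_col x y (usubmx (w : 'cV_(1 + 1))) (dsubmx (w : 'cV_(1 + 1))).
  rewrite vsubmxK => e; rewrite [LHS]e.
  rewrite [usubmx _]mx11_scalar [dsubmx _]mx11_scalar !mul_mx_scalar !mxE.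
  have l0 : lshift 1 (0 : 'I_1) = 0 by apply: val_inj.
  have r0 : rshift 1 (0 : 'I_1) = 1 by apply: val_inj.
  by rewrite l0 r0.
split=> [gen|uP z]; last first.
  pose w : 'cV[O]_2 := invmx (row_mx x y : 'M_2) *m z.
  by exists (w 0 0), (w 1 0); rewrite -comb mulKVmx.
have ex z : exists w : 'cV[O]_2, (row_mx x y : 'M_2) *m w = z.
  have [c [d ->]] := gen z.
  by exists (\col_i if i == 0 then c else d); rewrite comb !mxE.
have [w0 e0] := ex (col 0 1%:M); have [w1 e1] := ex (col 1 1%:M).
have e := mul_mx_row (row_mx x y : 'M_2) w0 w1.
by rewrite e0 e1 row_mx_cols in e; exact: (mulmx1_unit e).1.
Qed.

(** A Bezout relation u x1 + v x2 = 1 makes (-v, u) a second basis vector. This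
    is why the smallest value at vectors with coprime coordinates is the smallest
    upper left entry in the congruence class. *)
Lemma unit_ideal_complete (x : 'cV[O]_2) :
  unit_ideal x -> exists y, generate_O2 x y.
Proof.
case=> u [v uv]; pose y : 'cV[O]_2 := \col_i (if i == 0 then - v else u).
exists y => z; exists (u * z 0 0 + v * z 1 0), (x 0 0 * z 1 0 - x 1 0 * z 0 0).
apply/matrixP => i j; rewrite ord1 !mxE.
have [->|->] /= := ord2_cases i.
- by rewrite -[LHS]mul1r -uv; ring.
- by rewrite -[LHS]mul1r -uv; ring.
Qed.

(** * The total order on H *)

Lemma ltO_trans (x y z : O) : ltO eps0 x y -> ltO eps0 y z -> ltO eps0 x z.
Proof. by rewrite /ltO => xy yz; rewrite -(subrKA y) addrC; apply: gt0O_add. Qed.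

Lemma ltH_trans (A B C : 'M[O]_2) : ltH eps0 A B -> ltH eps0 B C -> ltH eps0 A C.
Proof.
rewrite /ltH; case: (chi A) (chi B) (chi C) => [[a1 d1] b1] [[a2 d2] b2] [[a3 d3] b3].
case=> [ha|[-> [hd|[-> hb]]]] [ka|[<- [kd|[<- kb]]]]; try by left.
- by left; apply: ltn_trans ka.
- by right; split=> //; left; apply: ltn_trans kd.
- by right; split=> //; left.
- by right; split=> //; left.
- by right; split=> //; right; split=> //; apply: ltO_trans kb.
Qed.

Lemma ltH_irr (A : 'M[O]_2) : ~ ltH eps0 A A.
Proof.
rewrite /ltH; case: (chi A) => [[a d] b]; rewrite !ltnn /ltO subrr.
by case=> // -[_] [//|[_]]; apply: gt0O_irr.
Qed.

(** The missing lower left entry is the conjugate of b, by Hermitian symmetry. *)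
Lemma chi_inj (A B : 'M[O]_2) :
  inH eps0 A -> inH eps0 B -> chi A = chi B -> A = B.
Proof.
move=> hA hB; rewrite /chi.
have [a Aa _] := inH_diag A 0 hA; have [d Ad _] := inH_diag A 1 hA.
have [a' Ba _] := inH_diag B 0 hB; have [d' Bd _] := inH_diag B 1 hB.
rewrite Aa Ad Ba Bd !natO_nat => -[ea ed eb].
case: hA hB => [hA _ _] [hB _ _]; apply/matrixP => i j.
have [->|->] := ord2_cases i; have [->|->] := ord2_cases j; rewrite ?Aa ?Ba ?Ad ?Bd ?ea ?ed //.
by rewrite -hA -hB !mxE eb.
Qed.

Lemma leH_total (A B : 'M[O]_2) :
  inH eps0 A -> inH eps0 B -> leH eps0 A B \/ leH eps0 B A.
Proof.
move=> hA hB; have := chi_inj A B hA hB; rewrite /leH /ltH.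
case: (chi A) (chi B) => [[a1 d1] b1] [[a2 d2] b2] inj.
have [a|a|ea] := ltngtP a1 a2; [by left; left; left|by right; left; left|].
have [d|d|ed] := ltngtP d1 d2.
- by left; left; right; split=> //; left.
- by right; left; right; split=> //; left.
have [eb|nb] := eqVneq b1 b2; first by left; right; apply: inj; rewrite ea ed eb.
have := gt0O_total (b2 - b1); rewrite subr_eq0 eq_sym => /(_ nb); rewrite opprB.
case=> h; [left|right]; left; right; split=> //; right; split=> //.
Qed.

Lemma leH_trans (A B C : 'M[O]_2) : leH eps0 A B -> leH eps0 B C -> leH eps0 A C.
Proof.
move=> [AB|->] // [BC|<-]; last by left.
by left; apply: ltH_trans BC.
Qed.

Lemma leH_anti (A B : 'M[O]_2) : leH eps0 A B -> leH eps0 B A -> A = B.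
Proof. by move=> [AB|->] // [BA|//]; case: (@ltH_irr A (ltH_trans _ _ _ AB BA)). Qed.

(** Lets the last step of the algorithm always succeed. Total comparison needs
    the matrices to be in H, where chi is injective. *)
Lemma leH_min (s : seq 'M[O]_2) : (forall A, A \in s -> inH eps0 A) ->
  s <> [::] -> exists2 N, N \in s & forall A, A \in s -> leH eps0 N A.
Proof.
elim: s => [_ /(_ erefl)//|A [|B s] IH] hs _.
  by exists A => [|B]; rewrite inE // => /eqP ->; right.
have [C|//|N Ns Nmin] := IH; first by move=> Cs; apply: hs; rewrite inE Cs orbT.
have [NA|AN] := leH_total N A (hs N (mem_behead (s := A :: B :: s) Ns)) (hs A (mem_head _ _)).
  exists N => [|C]; first by rewrite inE Ns orbT.
  by rewrite inE => /orP[/eqP->//|/Nmin].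
exists A => [|C]; first by rewrite mem_head.
by rewrite inE => /orP[/eqP->|/Nmin]; [right|apply: leH_trans].
Qed.

Lemma reduced_unique (A N N' : 'M[O]_2) :
  reduced eps0 N -> congruentO eps0 A N ->
  reduced eps0 N' -> congruentO eps0 A N' -> N = N'.
Proof.
move=> [hN Nmin] AN [hN' Nmin'] AN'.
have NN' : congruentO eps0 N N' by apply: congruentO_trans AN'; apply: congruentO_sym.
by apply: leH_anti; [apply: Nmin|apply: Nmin' => //; apply: congruentO_sym].
Qed.

(** * The least values and the reduced matrix *)

Lemma candidatesP (M : 'M[O]_2) A D N : N \in candidates eps0 M A D <->
  exists x y, [/\ x \in A, y \in D, generate_O2 x y & N = on_basis eps0 M x y].
Proof.
split=> [/imfset2P[x /= xA [y]]|[x [y [xA yD g ->]]]].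
  by rewrite !inE => /andP[yD /asboolP g] ->; exists x, y.
by apply/imfset2P; exists x => //; exists y => //; rewrite !inE yD asboolT.
Qed.

Lemma on_basis_congruent (M : 'M[O]_2) x y :
  generate_O2 x y -> congruentO eps0 M (on_basis eps0 M x y).
Proof. by move=> /generate_O2P g; exists (row_mx x y). Qed.

Lemma on_basis_diag (M : 'M[O]_2) x y :
  on_basis eps0 M x y 0 0 = val_at M x /\ on_basis eps0 M x y 1 1 = val_at M y.
Proof.
have [ex ey] := cols_row_mx x y.
by rewrite /on_basis; split; [rewrite congr_diag ex|rewrite congr_diag ey].
Qed.

Lemma generate_unit_ideal (x y : 'cV[O]_2) :
  generate_O2 x y -> unit_ideal x /\ unit_ideal y.
Proof.
have [ex ey] := cols_row_mx x y; move=> /generate_O2P g.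
by rewrite -{1}ex -{2}ey; split; apply: unit_ideal_col.
Qed.

Variable M : 'M[O]_2.
Hypothesis hM : inH eps0 M.
Local Notation step := (Defs.step eps0 M).

Definition least_first (a : nat) : Prop :=
  (exists2 x, unit_ideal x & val_at M x = a%:R) /\
  forall x n, unit_ideal x -> val_at M x = n%:R -> (a <= n)%N.

Definition least_second (a d : nat) : Prop :=
  (exists x y, [/\ generate_O2 x y, val_at M x = a%:R & val_at M y = d%:R]) /\
  forall x y n, generate_O2 x y -> val_at M x = a%:R -> val_at M y = n%:R ->
    (d <= n)%N.

Lemma least_first_exists : exists a, least_first a.
Proof.
have [|a [x ux xa] amin] :=
  @least_nat (fun a => exists2 x, unit_ideal x & val_at M x = a%:R).
  have [n xn _] := val_at_nat M (col 0 1%:M) hM.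
  by exists n, (col 0 1%:M) => //; apply/unit_ideal_col/unitmx1.
exists a; split; first by exists x.
by move=> y n uy yn; apply: amin; exists y.
Qed.

Lemma least_second_exists a : least_first a -> exists d, least_second a d.
Proof.
move=> [[x ux xa] _].
have [|d [z [y [zy za yd]]] dmin] := @least_nat (fun d => exists x y,
  [/\ generate_O2 x y, val_at M x = a%:R & val_at M y = d%:R]).
  have [y xy] := unit_ideal_complete x ux; have [n yn _] := val_at_nat M y hM.
  by exists n, x, y.
exists d; split; first by exists z, y.
by move=> u v n uv ua vn; apply: dmin; exists u, v.
Qed.

(** The columns of an invertible P have coprime coordinates and generate O^2.
    So the upper left entry of any matrix congruent to M is at least a, the lower
    right one is at least d if the first equals a, and when both are attained
    the matrix is among those compared to N. *)
Lemma reduced_of_least a d N : least_first a -> least_second a d ->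
  (exists x y, [/\ generate_O2 x y, val_at M x = a%:R, val_at M y = d%:R
     & N = on_basis eps0 M x y]) ->
  (forall x y, generate_O2 x y -> val_at M x = a%:R -> val_at M y = d%:R ->
     leH eps0 N (on_basis eps0 M x y)) ->
  reduced eps0 N /\ congruentO eps0 M N.
Proof.
move=> [_ amin] [_ dmin] [x [y [g xa yd ->]]] Nmin.
have MN := on_basis_congruent M x y g.
split=> //; split; first exact: congruentO_inH MN.
move=> N' hN' /(congruentO_trans _ _ _ MN)[P [uP eN']].
have eP : N' = on_basis eps0 M (col 0 P) (col 1 P) by rewrite /on_basis row_mx_cols.
have gP : generate_O2 (col 0 P) (col 1 P) by apply/generate_O2P; rewrite row_mx_cols.
have [n0 e0 _] := val_at_nat M (col 0 P) hM.
have [n1 e1 _] := val_at_nat M (col 1 P) hM.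
have [u0 u1] := generate_unit_ideal _ _ gP.
rewrite {hN' eN' N'}eP.
have [N00 N11] := on_basis_diag M x y.
have [P00 P11] := on_basis_diag M (col 0 P) (col 1 P).
have := amin _ _ u0 e0; rewrite leq_eqVlt => /orP[/eqP ea|lt]; last first.
  by left; rewrite /ltH /chi N00 P00 xa e0 !natO_nat; left.
rewrite -ea in e0.
have := dmin _ _ _ gP e0 e1; rewrite leq_eqVlt => /orP[/eqP ed|lt]; last first.
  left; rewrite /ltH /chi N00 P00 N11 P11 xa e0 yd e1 !natO_nat.
  by right; split=> //; left.
by apply: Nmin => //; rewrite e1 -ed.
Qed.

Variables a d : nat.
Hypotheses (ha : least_first a) (hd : least_second a d).

Lemma least_first_gt0 : (0 < a)%N.
Proof.
have [[x [u [v uv]] xa] _] := ha; have [n xn] := val_at_nat M x hM.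
have -> : a = n by apply: emb_nat_inj; rewrite -xa -xn.
apply; apply/eqP => x0; move: uv; rewrite x0 !mxE !mulr0 addr0 => /esym/eqP.
by rewrite oner_eq0.
Qed.

(** The second basis vector has coprime coordinates too; hence the search for d
    may start at a, as the algorithm does. *)
Lemma least_first_le_second : (a <= d)%N.
Proof.
have [[x [y [/generate_unit_ideal[_ uy] _ yd]]] _] := hd.
exact: (ha.2 _ _ uy yd).
Qed.

(** * The run of the algorithm *)

(** The counter never overshoots: it stays at most a while the first vectors are
    sought, and at most d afterwards. *)
Definition run_invariant (s : state K) : Prop :=
  match s with
  | AtA e => (e <= a)%N
  | AtD A e => is_level_set eps0 M a A /\ (e <= d)%N
  | AtM A D e =>
      [/\ is_level_set eps0 M a A, is_level_set eps0 M e D & (e <= d)%N]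
  | Halt N => reduced eps0 N /\ congruentO eps0 M N
  end.

(** The remaining work. Each value of the second counter costs two transitions,
    hence the doubling, and the constants order the control points inside one
    value of the counters. *)
Definition run_rank (s : state K) : nat :=
  match s with
  | AtA e => (a - e) + (d - a).*2 + 3
  | AtD _ e => (d - e).*2 + 2
  | AtM _ _ e => (d - e).*2 + 1
  | Halt _ => 0
  end.

(** A level set found empty, or without any generating pair, witnesses that its
    counter is not yet at the least value, so incrementing is safe; a nonempty
    first level set forces the counter to be a, and a candidate forces the
    second counter to be d. *)
Lemma step_invariant s t : run_invariant s -> step s t ->
  run_invariant t /\ (run_rank t < run_rank s)%N.
Proof.
have ad := least_first_le_second.
move=> + st; case: st => /=.
- move=> e A lA A0 ea; suff : e <> a by lia.
  move=> eea; have [[x ux xa] _] := ha.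
  have /lA : val_at M x = e%:R /\ unit_ideal x by rewrite eea.
  by rewrite A0 inE.
- move=> e A lA /eqP/fset0Pn[x /lA[xe ux]] ea.
  have ae := ha.2 _ _ ux xe; have eea : e = a by lia.
  by rewrite -eea; split; [split=> //; lia|lia].
- move=> A e D lD D0 [lA ed]; suff : e <> d by split; [split=> //; lia|lia].
  move=> eed; have [[x [y [g xa yd]]] _] := hd.
  have [_ uy] := generate_unit_ideal _ _ g.
  have /lD : val_at M y = e%:R /\ unit_ideal y by rewrite eed.
  by rewrite D0 inE.
- by move=> A e D lD _ [lA ed]; split; [split|lia].
- move=> A D e c0 [lA lD ed]; suff : e <> d by split; [split=> //; lia|lia].
  move=> eed; have [[x [y [g xa yd]]] _] := hd.
  have [ux uy] := generate_unit_ideal _ _ g.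
  suff : on_basis eps0 M x y \in candidates eps0 M A D by rewrite c0 inE.
  by apply/candidatesP; exists x, y; split=> //; [apply/lA|apply/lD; rewrite eed].
- move=> A D e N cN Nmin [lA lD ed].
  have [x [y [/lA[xa ux] /lD[ye uy] g NE]]] := (candidatesP M A D N).1 cN.
  have eed : e = d by have := hd.2 _ _ _ g xa ye; lia.
  rewrite {}eed in ed lD ye *; split; last by rewrite addn1.
  apply: (reduced_of_least a d) => //; first by exists x, y.
  move=> u v guv ua vd; have [uu uv] := generate_unit_ideal _ _ guv.
  by apply/Nmin/candidatesP; exists u, v; split=> //; [apply/lA|apply/lD].
Qed.

Lemma invariant_Acc s : run_invariant s -> Acc (fun t s => step s t) s.
Proof.
move: {2}(run_rank s).+1 (ltnSn (run_rank s)) => n.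
elim: n s => [s|n IH s]; first by rewrite ltn0.
move=> rs ivs; constructor=> t /(step_invariant _ _ ivs)[it rt].
by apply: IH it; apply: leq_trans rt _.
Qed.

(** The only obstacles to a transition would be an infinite level set or a
    finite nonempty set of candidates without a smallest element. *)
Lemma step_progress s : (exists t, step s t) \/ exists N, s = Halt N.
Proof.
case: s => [e|A e|A D e|N]; last by right; exists N.
- left; have [A lA] := level_set_exists M e hM.
  have [A0|/eqP A0] := eqVneq A fset0%fset; first by exists (AtA K e.+1); apply: step_incrA A0.
  by exists (AtD A e); apply: step_foundA A0.
- left; have [D lD] := level_set_exists M e hM.
  have [D0|/eqP D0] := eqVneq D fset0%fset; first by exists (AtD A e.+1); apply: step_incrD D0.
  by exists (AtM A D e); apply: step_foundD D0.
- left; have [c0|c0] := eqVneq (candidates eps0 M A D) fset0.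
    by exists (AtD A e.+1); apply: step_retry.
  have [|c1|N cN Nmin] := leH_min (candidates eps0 M A D).
  + move=> N /candidatesP[x [y [_ _ g ->]]].
    by apply: congruentO_inH hM (on_basis_congruent _ _ _ g).
  + by case/fset0Pn: c0 => N; rewrite -[_ \in _]/(N \in enum_fset _) c1.
  + by exists (Halt N); apply: step_halt.
Qed.

Lemma invariant_start : run_invariant (start K).
Proof. exact: least_first_gt0. Qed.

Lemma reachable_invariant s : reachable eps0 M s -> run_invariant s.
Proof.
by elim=> [|u t _ iu ut]; [exact: invariant_start|exact: (step_invariant _ _ iu ut).1].
Qed.

Lemma some_output : exists N, outputs eps0 M N.
Proof.
have: reachable eps0 M (start K) by constructor.
elim: (invariant_Acc _ invariant_start) => s _ IH rs.
have [[t st]|[N eN]] := step_progress s; last by exists N; rewrite /outputs -eN.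
by apply: (IH t st); apply: reach_step st.
Qed.

End Algorithm.

Theorem theorem3p8 (R : realType) (K : fieldExtType rat)
    (hK : imaginary_quadratic R K) (eps0 : {rmorphism K -> R[i]})
    (M : 'M[maxorder K]_2) (hM : inH eps0 M) :
  terminates eps0 M /\
  exists N : 'M[maxorder K]_2,
    (forall N' : 'M[maxorder K]_2, outputs eps0 M N' <-> N' = N) /\
    unique (fun N' : 'M[maxorder K]_2 =>
              reduced eps0 N' /\ congruentO eps0 M N') N.
Proof.
have [a ha] := least_first_exists _ _ _ hK M hM.
have [d hd] := least_second_exists _ _ _ hK M hM a ha.
split.
  split.
    apply: (invariant_Acc _ _ _ hK M hM a d ha hd).
    exact: (invariant_start _ _ _ hK M hM a d ha).
  by move=> s _; exact: step_progress _ _ _ hK M hM s.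
have [N oN] := some_output _ _ _ hK M hM a d ha hd.
have correct N' : outputs eps0 M N' -> reduced eps0 N' /\ congruentO eps0 M N'.
  exact: (reachable_invariant _ _ _ hK M hM a d ha hd (Halt N')).
have [rN cN] := correct _ oN.
exists N; split=> [N'|]; last first.
  by split=> // N' [rN' cN']; apply: reduced_unique _ _ _ hK M N N' rN cN rN' cN'.
split=> [/correct[rN' cN']|->//].
exact: (reduced_unique _ _ _ hK M N' N rN' cN' rN cN).
Qed.
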